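(* The following statements are equivalent: (1) $\models_\Delta$ has the Beth definability property; (2) for every set of variables $\overline{x}$, variable $y\notin\overline{x}$, closed subset $X\subseteq[0,1]^{\overline{x}}$ and continuous function $\mathbf f\colon X\to[0,1]$, the theory $\Sigma_{\mathbf f}(\overline{x},y)$ explicitly defines $y$ over $\overline{x}$; (3) for every $\delta$-algebra $A$, the homomorphism $\eta_A\colon A\to C(\mathrm{Max}\,A,[0,1])$, $a\mapsto\hat a$, is an isomorphism; (4) every epimorphism in the category $\Delta$ of $\delta$-algebras and $\delta$-homomorphisms is surjective.
   Context: An MV-algebra is an algebra $(A,\oplus,\neg,0)$ of type $(2,1,0)$ such that $(A,\oplus,0)$ is a commutative monoid, $\neg\neg a=a$, $a\oplus\neg 0=\neg 0$, and $\neg(\neg a\oplus b)\oplus b=\neg(\neg b\oplus a)\oplus a$. Derived operations: $1:=\neg 0$, $a\odot b:=\neg(\neg a\oplus\neg b)$, $a\ominus b:=a\odot\neg b$, $a\vee b:=\neg(\neg a\oplus b)\oplus b$ (join of a lattice order $\le$), $d(a,b):=(a\ominus b)\oplus(b\ominus a)$. An ideal of an MV-algebra is a subset containing $0$, downward closed and closed under $\oplus$. Let $\mathcal{L}=\{\delta,\oplus,\neg,0\}$ of type $(\omega,2,1,0)$; $\tfrac12(x):=\delta(x,0,0,\dots)$. A $\delta$-algebra is an $\mathcal{L}$-algebra whose MV-reduct is an MV-algebra and satisfying for all $x,y,\vec x,\vec y$: (i) $d(\delta(\vec x),\delta(x_1,0,0,\dots))=\delta(0,x_2,x_3,\dots)$;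 (ii) $\tfrac12(\delta(\vec x))=\delta(\tfrac12(x_1),\tfrac12(x_2),\dots)$; (iii) $\delta(x,x,\dots)=x$; (iv) $\delta(0,\vec x)=\tfrac12(\delta(\vec x))$; (v) $\delta(\vec x)\le\delta(x_1\oplus y_1,x_2\oplus y_2,\dots)$; (vi) $\tfrac12(x\ominus y)=\tfrac12(x)\ominus\tfrac12(y)$. $\delta$-homomorphisms preserve $\delta,\oplus,\neg,0$. $[0,1]$ is the standard $\delta$-algebra with $x\oplus y=\min\{1,x+y\}$, $\neg x=1-x$, $\delta(\vec x)=\sum_i x_i/2^i$; for compact Hausdorff $X$, $C(X,[0,1])$ has pointwise MV-operations and $\delta(\vec{\mathbf g})=\sum_i\mathbf g_i/2^i$. $T(\overline{x})$: terms in $\overline{x}$; $F(\overline{x})$: free $\delta$-algebra over $\overline{x}$; $\rho\colon T(\overline{x})\to F(\overline{x})$ canonical quotient. For an assignment $f$ into an $\mathcal{L}$-algebra $A$, $A,f\models\Sigma$ means $\bar f(s)=\bar f(t)$ for all $s\approx t\in\Sigma$. $\Sigma\models_\Delta\sigma$ means every assignment into every $\delta$-algebra satisfying $\Sigma$ satisfies $\sigma$. For a $\delta$-algebra $A$, $\mathrm{Max}\,A$ is the space of MV-homomorphisms $A\to[0,1]$ with topology induced by $[0,1]^A$; $\hat a(h):=h(a)$; $V(S):=\{h: h(a)=0\ \forall a\in S\}$. $[0,1]^{\overline{w}}$ is identified with $\mathrm{Max}\,F(\overline{w})$ via $h\mapsto(w\mapsto h(\rho(w)))$. For a theory $\Sigma(\overline{x},y)$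 with $y\notin\overline{x}$ and a variable $z$, $\Sigma(\overline{x},z)$ replaces $y$ by $z$. $\Sigma$ implicitly defines $y$ over $\overline{x}$ if $\Sigma(\overline{x},y)\cup\Sigma(\overline{x},z)\models_\Delta y\approx z$ for every variable $z$; it explicitly defines $y$ over $\overline{x}$ if some term $s_y(\overline{x})$ satisfies $\Sigma(\overline{x},y)\models_\Delta y\approx s_y$. $\models_\Delta$ has the Beth definability property if every theory that implicitly defines $y$ over $\overline{x}$ explicitly defines $y$ over $\overline{x}$. Definition of $\Sigma_{\mathbf f}$: the graph $G_{\mathbf f}=\{g\in[0,1]^{\overline{x}\cup\{y\}}: g|_{\overline{x}}\in X,\ g(y)=\mathbf f(g|_{\overline{x}})\}$ is closed in $[0,1]^{\overline{x}\cup\{y\}}\cong\mathrm{Max}\,F(\overline{x},y)$; fix an ideal $J_{\mathbf f}$ of $F(\overline{x},y)$ with $V(J_{\mathbf f})=G_{\mathbf f}$, and set $\Sigma_{\mathbf f}:=\{s\approx 0: s\in T(\overline{x},y),\ \rho(s)\in J_{\mathbf f}\}$. *)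

(* Defs.v *)
From HB Require Import structures.
From mathcomp Require Import all_boot all_order all_algebra.
From mathcomp Require Import all_classical all_reals.
From mathcomp Require Import topology normedtype sequences.
From mathcomp Require Import Rstruct Rstruct_topology.

Set Implicit Arguments.
Unset Strict Implicit.
Unset Printing Implicit Defensive.

Import Order.TTheory GRing.Theory Num.Theory.
Local Open Scope classical_set_scope.
Local Open Scope ring_scope.

Notation R := Rdefinitions.R.

Definition unit_add (x y : R) : R := Num.min 1 (x + y).
Definition unit_neg (x : R) : R := 1 - x.
(* delta(x_1, x_2, ...) = sum_{i >= 1} x_i / 2^i; our sequences are indexed
   from 0, so x_{i+1} is [x i] and its weight is 1/2^(i+1). *)
Definition unit_delta (x : nat -> R) : R :=
  limn (fun n => \sum_(0 <= i < n) (x i / 2 ^+ i.+1)).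

Section Derived.
Variables (A : Type) (add : A -> A -> A) (neg : A -> A) (zero : A)
          (delta : (nat -> A) -> A).
Definition d_one := neg zero.
Definition d_odot a b := neg (add (neg a) (neg b)).
Definition d_ominus a b := d_odot a (neg b).
Definition d_join a b := add (neg (add (neg a) b)) b.
Definition d_le a b := d_join a b = b.
Definition d_dist a b := add (d_ominus a b) (d_ominus b a).
Definition d_half x := delta (fun i => if i is 0 then x else zero).

Definition is_MV : Prop :=
  (((forall a b c, add a (add b c) = add (add a b) c)) /\
     ((forall a b, add a b = add b a)) /\
     ((forall a, add a zero = a)) /\
     ((forall a, neg (neg a) = a)) /\
     ((forall a, add a (neg zero) = neg zero)) /\
     ((forall a b, add (neg (add (neg a) b)) b = add (neg (add (neg b) a)) a))).

Definition is_delta_axioms : Prop :=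
  ((
      (forall x : nat -> A,
         d_dist (delta x) (delta (fun i => if i is 0 then x 0 else zero))
         = delta (fun i => if i is 0 then zero else x i))) /\
     (
      (forall x : nat -> A, d_half (delta x) = delta (fun i => d_half (x i)))) /\
     (
      (forall x : A, delta (fun _ => x) = x)) /\
     (
      (forall x : nat -> A,
         delta (fun i => if i is j.+1 then x j else zero) = d_half (delta x))) /\
     (
      (forall x y : nat -> A, d_le (delta x) (delta (fun i => add (x i) (y i))))) /\
     (
      (forall x y : A, d_half (d_ominus x y) = d_ominus (d_half x) (d_half y)))).
End Derived.

Record deltaAlg := DeltaAlg {
  dcar :> Type;
  dadd : dcar -> dcar -> dcar;
  dneg : dcar -> dcar;
  dzero : dcar;
  ddelta : (nat -> dcar) -> dcar;
  dMV : is_MV dadd dneg dzero;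
  dDelta : is_delta_axioms dadd dneg dzero ddelta
}.

Definition is_delta_hom (A B : deltaAlg) (f : A -> B) : Prop :=
  (((forall x : nat -> A, f (ddelta x) = ddelta (fun i => f (x i)))) /\
     ((forall a b, f (dadd a b) = dadd (f a) (f b))) /\
     ((forall a, f (dneg a) = dneg (f a))) /\
     (f (dzero A) = dzero B)).

Definition is_epi (A B : deltaAlg) (f : A -> B) : Prop :=
  forall (C : deltaAlg) (g1 g2 : B -> C),
    is_delta_hom g1 -> is_delta_hom g2 ->
    (forall a, g1 (f a) = g2 (f a)) -> forall b, g1 b = g2 b.

Inductive term (V : Type) : Type :=
| tVar : V -> term V
| tZero : term V
| tNeg : term V -> term V
| tAdd : term V -> term V -> term V
| tDelta : (nat -> term V) -> term V.
Arguments tZero {V}.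

Fixpoint eval (A : deltaAlg) (V : Type) (g : V -> A) (t : term V) : A :=
  match t with
  | tVar v => g v
  | tZero => dzero A
  | tNeg s => dneg (eval g s)
  | tAdd s u => dadd (eval g s) (eval g u)
  | tDelta f => ddelta (fun n => eval g (f n))
  end.

Fixpoint rename (V W : Type) (r : V -> W) (t : term V) : term W :=
  match t with
  | tVar v => tVar (r v)
  | tZero => tZero
  | tNeg s => tNeg (rename r s)
  | tAdd s u => tAdd (rename r s) (rename r u)
  | tDelta f => tDelta (fun n => rename r (f n))
  end.

Definition equation (V : Type) := (term V * term V)%type.
Definition theory (V : Type) := set (equation V).

Definition satisfies (A : deltaAlg) (V : Type) (g : V -> A) (S : theory V) :=
  forall e, S e -> eval g e.1 = eval g e.2.

Definition entails (V : Type) (S : theory V) (e : equation V) : Prop :=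
  forall (A : deltaAlg) (g : V -> A), satisfies g S -> eval g e.1 = eval g e.2.

Definition rename_theory (V W : Type) (r : V -> W) (S : theory V) : theory W :=
  [set e | exists2 e', S e' & e = (rename r e'.1, rename r e'.2)].

(* Theories Sigma(xbar, y) in the variables xbar (= X) and y: the variables
   are [option X], with [None] standing for y and [Some x] for x in xbar.
   For Sigma(xbar, y) u Sigma(xbar, z) we use the variables
   [option (option X)]: [None] = y, [Some None] = z (a fresh variable),
   [Some (Some x)] = x. *)
Definition to_y (X : Type) (w : option X) : option (option X) :=
  if w is Some x then Some (Some x) else None.
Definition to_z (X : Type) (w : option X) : option (option X) :=
  if w is Some x then Some (Some x) else Some None.

Definition implicitly_defines (X : Type) (S : theory (option X)) : Prop :=
  entails (rename_theory (@to_y X) S `|` rename_theory (@to_z X) S)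
          (tVar None, tVar (Some None)).

Definition explicitly_defines (X : Type) (S : theory (option X)) : Prop :=
  exists s : term X, entails S (tVar None, rename Some s).

Definition Beth_property : Prop :=
  forall (X : Type) (S : theory (option X)),
    implicitly_defines S -> explicitly_defines S.

(* The free delta-algebra F(W), presented as terms modulo |=_Delta     *)

Definition Feq (W : Type) (s t : term W) : Prop := entails set0 (s, t).

Definition tJoin (W : Type) (s t : term W) : term W :=
  tAdd (tNeg (tAdd (tNeg s) t)) t.

Definition Fle (W : Type) (s t : term W) : Prop := Feq (tJoin s t) t.

(* J (a predicate on terms saturated under Feq, i.e. a subset of F(W)) is an
   ideal of F(W) *)
Definition is_F_ideal (W : Type) (J : set (term W)) : Prop :=
  (((forall s t, Feq s t -> J s -> J t)) /\
     (J tZero) /\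
     ((forall s t, Fle s t -> J t -> J s)) /\
     ((forall s t, J s -> J t -> J (tAdd s t)))).

Definition mvhom01 (T : Type) (add : T -> T -> T) (neg : T -> T) (zero : T)
  (h : T -> R) : Prop :=
  (((forall a, 0 <= h a <= 1)) /\
     ((forall a b, h (add a b) = unit_add (h a) (h b))) /\
     ((forall a, h (neg a) = unit_neg (h a))) /\
     (h zero = 0)).

(* Max F(W): MV-homomorphisms F(W) -> [0,1] (functions on terms constant on
   Feq-classes) *)
Definition MaxF (W : Type) (h : term W -> R) : Prop :=
  (forall s t, Feq s t -> h s = h t) /\
  mvhom01 (@tAdd W) (@tNeg W) tZero h.

(* Max A, as a subset of [0,1]^A carrying the product topology *)
Definition MaxSet (A : deltaAlg) : set {ptws A -> R} :=
  [set h | mvhom01 (@dadd A) (@dneg A) (dzero A) h].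
Arguments MaxSet : clear implicits.

(* eta_A : A -> C(Max A, [0,1]), a |-> hat a, is an isomorphism of
   delta-algebras: it is a delta-homomorphism (operations of C(Max A,[0,1])
   are pointwise, with delta(g) = sum g_i/2^i), injective, and onto the
   continuous [0,1]-valued functions on Max A. Elements of C(Max A,[0,1]) are
   functions on Max A, so equalities are taken on Max A. *)
Definition eta_is_iso (A : deltaAlg) : Prop :=
  ((
      (forall (x : nat -> A) (h : A -> R), MaxSet A h ->
         h (ddelta x) = unit_delta (fun i => h (x i)))) /\
     ((forall (a b : A) (h : A -> R), MaxSet A h -> h (dadd a b) = unit_add (h a) (h b))) /\
     ((forall (a : A) (h : A -> R), MaxSet A h -> h (dneg a) = unit_neg (h a))) /\
     ((forall h : A -> R, MaxSet A h -> h (dzero A) = 0)) /\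
     (
      (forall a b : A, (forall h : A -> R, MaxSet A h -> h a = h b) -> a = b)) /\
     (
      (forall phi : {ptws A -> R} -> R,
         {within MaxSet A, continuous phi} ->
         (forall h : A -> R, MaxSet A h -> 0 <= phi h <= 1) ->
         exists a : A, forall h : A -> R, MaxSet A h -> h a = phi h))).

Definition unit_cube (X : Type) : set {ptws X -> R} :=
  [set g | forall x, 0 <= g x <= 1].
Arguments unit_cube : clear implicits.

Definition graph_f (X : Type) (S : set {ptws X -> R}) (f : {ptws X -> R} -> R)
  : set (option X -> R) :=
  [set g | (forall w, 0 <= g w <= 1) /\
           S (fun x => g (Some x)) /\ g None = f (fun x => g (Some x))].

(* V(J) = G_f, under the identification Max F(W) = [0,1]^W,
   h |-> (w |-> h (rho w)) *)
Definition zero_set_is (W : Type) (J : set (term W)) (G : set (W -> R)) : Prop :=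
  forall h, MaxF h -> ((forall s, J s -> h s = 0) <-> G (fun w => h (tVar w))).

Definition Sigma_of_ideal (W : Type) (J : set (term W)) : theory W :=
  [set e | exists2 s, J s & e = (s, tZero)].

(* Main.v *)
(* All four statements hold.

   Every δ-algebra [A] is Archimedean, so for [a <> 0] some prime ideal [P] omits
   [a ⊖ 1/2^n]; the quotient [A/P] is a chain, and comparing its elements with
   the dyadic constants of [A] yields an MV-homomorphism [A -> [0,1]] that is
   positive at [a].  Hence [Max A] separates the points of [A], and every
   MV-homomorphism into [0,1] preserves δ because [δ(x) = x_1/2 + δ(x_2, ...)/2]
   holds in [A].

   Surjectivity statements all reduce to one Stone-Weierstrass theorem: on a
   compact set [K] of [0,1]-valued functions, a separating family closed under
   the operations of [0,1] contains every continuous [phi : K -> [0,1]].  By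
   Urysohn's construction inside the family there is a member [u] with
   [2 phi - 1 <= u <= 2 phi]; iterating on [2 phi - u] writes [phi] as
   [δ(u_1, u_2, ...)].  With [K = Max A] this is (3).  For an epimorphism
   [A -> B], homomorphisms [B -> [0,1]] are determined by their restriction to
   [A], whence (4).  If a theory implicitly defines [y], its [0,1]-valued models
   are determined by their values on [xbar], whence (1), which gives (2) since
   the graph of a function implicitly defines its value. *)

Require Import Defs.
From HB Require Import structures.
From mathcomp Require Import all_boot all_order all_algebra.
From mathcomp Require Import all_classical all_reals.
From mathcomp Require Import topology normedtype sequences.
From mathcomp Require Import Rstruct Rstruct_topology.
From mathcomp Require Import lra ring zify.
Import Order.TTheory GRing.Theory Num.Theory.
Local Open Scope classical_set_scope.
Local Open Scope ring_scope.

Set Implicit Arguments.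
Unset Strict Implicit.
Unset Printing Implicit Defensive.

(* Order and cancellation in MV-algebras *)
Declare Scope mv_scope.
Delimit Scope mv_scope with mv.

Definition mv_one (A : deltaAlg) : A := d_one (@dneg A) (dzero A).
Definition mv_sub (A : deltaAlg) (a b : A) : A := d_ominus (@dadd A) (@dneg A) a b.
(* Equivalent to [d_le], cf. [mv_leE], but stable under residuation by mere
   associativity. *)
Definition mv_le (A : deltaAlg) (a b : A) : Prop := dadd (dneg a) b = mv_one A.
Definition mv_half (A : deltaAlg) (a : A) : A := d_half (dzero A) (@ddelta A) a.
Definition mv_mul (A : deltaAlg) (n : nat) (a : A) : A := iter n (dadd a) (dzero A).
Arguments mv_one : clear implicits.

Notation "0" := (dzero _) : mv_scope.
Notation "1" := (mv_one _) : mv_scope.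
Notation "a ⊕ b" := (dadd a b) (at level 50, left associativity) : mv_scope.
Notation "a ⊖ b" := (mv_sub a b) (at level 50, left associativity) : mv_scope.
Notation "¬ a" := (dneg a) (at level 35, right associativity) : mv_scope.
Notation "a ≤ b" := (mv_le a b) (at level 70) : mv_scope.
Notation "n · a" := (mv_mul n%N a) (at level 40) : mv_scope.
Notation "½ a" := (mv_half a) (at level 35, right associativity) : mv_scope.

Section MVAlgebra.
Local Open Scope mv_scope.
Context {A : deltaAlg}.
Implicit Types a b c x y z : A.

Lemma mv_addA a b c : a ⊕ (b ⊕ c) = a ⊕ b ⊕ c.
Proof. by case: (dMV A). Qed.
Lemma mv_addC a b : a ⊕ b = b ⊕ a.
Proof. by case: (dMV A) => _ []. Qed.
Lemma mv_add0 a : a ⊕ 0 = a.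
Proof. by case: (dMV A) => _ [_ []]. Qed.
Lemma mv_negK a : ¬ ¬ a = a.
Proof. by case: (dMV A) => _ [_ [_ []]]. Qed.
Lemma mv_add1 a : a ⊕ 1 = 1.
Proof. by case: (dMV A) => _ [_ [_ [_ []]]]. Qed.
Lemma mv_joinC a b : ¬ (¬ a ⊕ b) ⊕ b = ¬ (¬ b ⊕ a) ⊕ a.
Proof. by case: (dMV A) => _ [_ [_ [_ []]]]. Qed.
Lemma mv_add0l a : 0 ⊕ a = a.
Proof. by rewrite mv_addC mv_add0. Qed.
Lemma mv_add1l a : 1 ⊕ a = 1.
Proof. by rewrite mv_addC mv_add1. Qed.
Lemma mv_neg0 : ¬ (0 : A) = 1.
Proof. by []. Qed.
Lemma mv_neg1 : ¬ (1 : A) = 0.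
Proof. by rewrite -mv_neg0 mv_negK. Qed.
Lemma mv_addAC a b c : a ⊕ b ⊕ c = a ⊕ c ⊕ b.
Proof. by rewrite -mv_addA (mv_addC b) mv_addA. Qed.

Lemma mv_subE a b : a ⊖ b = ¬ (¬ a ⊕ b).
Proof. by rewrite /mv_sub /d_ominus /d_odot mv_negK. Qed.

Lemma mv_le_refl a : a ≤ a.
Proof.
have := mv_joinC a 1.
by rewrite mv_add1 mv_neg1 mv_add0l => e; rewrite /mv_le -e.
Qed.
Hint Resolve mv_le_refl : core.

Lemma mv_leE a b : d_le (@dadd A) (@dneg A) a b <-> a ≤ b.
Proof.
rewrite /d_le /d_join /mv_le; split=> [<-|->].
  by rewrite mv_addA mv_addAC mv_addC; apply: mv_le_refl.
by rewrite mv_neg1 mv_add0l.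
Qed.

Lemma mv_le_addr a b : a ≤ a ⊕ b.
Proof. by rewrite /mv_le mv_addA mv_le_refl mv_add1l. Qed.
Lemma mv_le_addl a b : a ≤ b ⊕ a.
Proof. by rewrite mv_addC; apply: mv_le_addr. Qed.

Lemma mv_subK a b : b ≤ a -> (a ⊖ b) ⊕ b = a.
Proof. by move=> le; rewrite mv_subE mv_joinC le mv_neg1 mv_add0l. Qed.

Lemma mv_le_subl a b c : a ⊖ b ≤ c <-> a ≤ b ⊕ c.
Proof. by rewrite /mv_le mv_subE mv_negK mv_addA. Qed.

Lemma mv_le_anti a b : a ≤ b -> b ≤ a -> a = b.
Proof.
move=> ab ba; rewrite -[LHS](mv_subK ba) -[RHS](mv_subK ab).
by rewrite !mv_subE mv_joinC.
Qed.

Lemma mv_le_trans b a c : a ≤ b -> b ≤ c -> a ≤ c.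
Proof.
move=> ab bc; rewrite -(mv_subK bc) -(mv_subK ab) mv_addA.
exact: mv_le_addl.
Qed.

Lemma mv_le0x a : 0 ≤ a.
Proof. by rewrite /mv_le mv_neg0 mv_add1l. Qed.
Lemma mv_lex1 a : a ≤ 1.
Proof. by rewrite /mv_le mv_add1. Qed.
Lemma mv_lex0 a : a ≤ 0 -> a = 0.
Proof. by move=> a0; apply: mv_le_anti (mv_le0x _). Qed.
Hint Resolve mv_le0x mv_lex1 : core.

Lemma mv_le_add a b c d : a ≤ b -> c ≤ d -> a ⊕ c ≤ b ⊕ d.
Proof.
have key (u v w : A) : u ≤ v -> u ⊕ w ≤ v ⊕ w.
  by move=> uv; rewrite -(mv_subK uv) -mv_addA; exact: mv_le_addl.
move=> ab cd; apply: (mv_le_trans (key _ _ c ab)).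
by rewrite !(mv_addC b); exact: key.
Qed.

Lemma mv_le_neg a b : a ≤ b <-> ¬ b ≤ ¬ a.
Proof. by rewrite /mv_le mv_negK mv_addC. Qed.

Lemma mv_le_sub a b c d : a ≤ b -> d ≤ c -> a ⊖ c ≤ b ⊖ d.
Proof.
move=> ab dc; rewrite !mv_subE -mv_le_neg.
by apply: mv_le_add => //; rewrite -mv_le_neg.
Qed.

Lemma mv_sub_le a b : a ⊖ b ≤ a.
Proof. by rewrite mv_le_subl; exact: mv_le_addl. Qed.

Lemma mv_subxx a : a ⊖ a = 0.
Proof. by rewrite mv_subE mv_le_refl mv_neg1. Qed.

Lemma mv_sub_eq0 a b : a ⊖ b = 0 <-> a ≤ b.
Proof.
split=> [e|ab]; last by rewrite mv_subE ab mv_neg1.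
by rewrite -(mv_add0 b) -mv_le_subl e.
Qed.

Lemma mv_sub_le_neg a b : a ⊖ b ≤ ¬ b.
Proof. by rewrite mv_subE -mv_le_neg; exact: mv_le_addl. Qed.

(** The bound [a ≤ ¬ b] says that the sum is not truncated at 1, which is what makes cancelling [b]
    possible. *)
Lemma mv_addK a b : a ≤ ¬ b -> (a ⊕ b) ⊖ b = a.
Proof.
move=> ab; rewrite -[RHS]mv_negK mv_subE; congr (¬ _).
have ba : b ≤ ¬ a by rewrite mv_le_neg mv_negK.
by rewrite -[RHS](mv_subK ba) mv_subE mv_negK.
Qed.

Lemma mv_dist_eq0 a b : d_dist (@dadd A) (@dneg A) a b = 0 -> a = b.
Proof.
rewrite /d_dist -!/(mv_sub _ _) => e.
by apply: mv_le_anti; rewrite -mv_sub_eq0; apply: mv_lex0; rewrite -e;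
  [exact: mv_le_addr | exact: mv_le_addl].
Qed.

Lemma mv_dist_ge a b : b ≤ a -> d_dist (@dadd A) (@dneg A) a b = a ⊖ b.
Proof. by rewrite /d_dist -!/(mv_sub _ _) -mv_sub_eq0 => ->; rewrite mv_add0. Qed.

Lemma mv_mulS n a : n.+1 · a = a ⊕ n · a.
Proof. by []. Qed.

Lemma mv_mul1 a : 1 · a = a.
Proof. exact: mv_add0. Qed.

Lemma mv_mulDl m n a : (m + n) · a = m · a ⊕ n · a.
Proof.
by elim: m => [|m IH]; rewrite ?mv_add0l // addSn !mv_mulS IH mv_addA.
Qed.

Lemma mv_mulA m n a : (m * n) · a = m · (n · a).
Proof. by elim: m => // m IH; rewrite mulSn mv_mulDl IH. Qed.

Lemma mv_mul_le m a b : a ≤ b -> m · a ≤ m · b.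
Proof. by move=> ab; elim: m => // m IH; rewrite !mv_mulS; apply: mv_le_add. Qed.

Lemma mv_mul_le2 m n a : (m <= n)%N -> m · a ≤ n · a.
Proof. by move/subnKC <-; rewrite mv_mulDl; exact: mv_le_addr. Qed.

(** This is the vanishing of the meet, expressed through lower bounds. *)
Definition mv_disjoint a b := forall z, z ≤ a -> z ≤ b -> z = 0.

Lemma mv_disjointC a b : mv_disjoint a b -> mv_disjoint b a.
Proof. by move=> ab z zb za; apply: ab. Qed.

(** The element [m] is the meet of [a] and [b]. If [z] lies below both differences, [z ⊕ m] is still
    below [a] and [b], so [z ⊕ m ≤ m], and cancelling [m] leaves [z = 0]. *)
Lemma mv_sub_disjoint a b : mv_disjoint (a ⊖ b) (b ⊖ a).
Proof.
move=> z za zb; pose m := a ⊖ (a ⊖ b).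
have ma : m ≤ a by exact: mv_sub_le.
have mb : m ≤ b by rewrite mv_le_subl mv_subE mv_joinC; exact: mv_le_addl.
have lb (t : A) : t ≤ a -> t ≤ b -> t ≤ m.
  move=> ta tb; rewrite /m !mv_subE mv_le_neg mv_negK.
  (* De Morgan: the complement of [m] is the join of [¬ a] and [¬ b]. *)
  rewrite (_ : ¬ a ⊕ _ = (¬ a ⊖ ¬ b) ⊕ ¬ b); last first.
    by rewrite !mv_subE mv_joinC !mv_negK (mv_addC b) mv_addC.
  rewrite mv_le_neg in ta; rewrite mv_le_neg in tb.
  rewrite -(mv_subK tb); apply: mv_le_add => //.
  by apply: mv_le_sub.
have zam : z ≤ a ⊖ m by apply: mv_le_trans za _; apply: mv_le_sub.
have zbm : z ≤ b ⊖ m by apply: mv_le_trans zb _; apply: mv_le_sub.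
have zm : z ⊕ m ≤ m.
  by apply: lb; [rewrite -(mv_subK ma)|rewrite -(mv_subK mb)]; apply: mv_le_add.
rewrite -(@mv_addK z m); first by rewrite mv_sub_eq0.
by apply: mv_le_trans zam _; exact: mv_sub_le_neg.
Qed.

(** If [z] is below [a] and [b ⊕ c], then [z ⊖ c] is below [a] and [b], so it vanishes and
    [z ≤ c]. *)
Lemma mv_disjoint_add a b c :
  mv_disjoint a b -> mv_disjoint a c -> mv_disjoint a (b ⊕ c).
Proof.
move=> ab ac z za zbc; apply: ac => //; rewrite -mv_sub_eq0.
apply: ab; first by apply: mv_le_trans za; exact: mv_sub_le.
by rewrite mv_le_subl mv_addC.
Qed.

Lemma mv_disjoint_mul m n a b :
  mv_disjoint a b -> mv_disjoint (m · a) (n · b).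
Proof.
have key k (x y : A) : mv_disjoint x y -> mv_disjoint x (k · y).
  move=> xy; elim: k => [|k IH]; last by rewrite mv_mulS; apply: mv_disjoint_add.
  by move=> z _ /mv_lex0.
by move=> ab; apply/key/mv_disjointC/key/mv_disjointC.
Qed.

End MVAlgebra.
#[global] Hint Resolve mv_le_refl mv_le0x mv_lex1 : core.

(** * Halving, dyadic constants and the Archimedean property *)

Section DeltaAlgebra.
Local Open Scope mv_scope.
Context {A : deltaAlg}.
Implicit Types (a b c : A) (x y : nat -> A).

Lemma delta_mono x y : (forall i, x i ≤ y i) -> ddelta x ≤ ddelta y.
Proof.
move=> xy; have [_ [_ [_ [_ [mono _]]]]] := dDelta A.
have /mv_leE := mono x (fun i => y i ⊖ x i).
suff -> : (fun i => x i ⊕ (y i ⊖ x i)) = y by [].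
by apply: funext => i; rewrite mv_addC mv_subK.
Qed.

Lemma delta_cst a : ddelta (fun=> a) = a.
Proof. by case: (dDelta A) => _ [_ []]. Qed.

Lemma delta_half x : ½ (ddelta x) = ddelta (fun i => ½ (x i)).
Proof. by have [_ [h _]] := dDelta A; exact: h. Qed.

Lemma half_sub a b : ½ (a ⊖ b) = ½ a ⊖ ½ b.
Proof. by have [_ [_ [_ [_ [_ h]]]]] := dDelta A; exact: h. Qed.

(** Since [½ (x 0) ≤ ddelta x], the distance in axiom (i) is a subtraction. Axiom (iv) then
    identifies the remainder, a sequence with head 0, as half of the tail's δ. *)
Lemma delta_rec x : ddelta x = ½ (x 0%N) ⊕ ½ (ddelta (fun i => x i.+1)).
Proof.
have [dec [_ [_ [shift _]]]] := dDelta A.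
have le : ½ (x 0%N) ≤ ddelta x by apply: delta_mono => -[|i] /=.
rewrite -[LHS](mv_subK le) mv_addC; congr (_ ⊕ _).
rewrite -(mv_dist_ge le) dec -[RHS]shift.
by congr ddelta; apply: funext => -[].
Qed.

Lemma half_mono a b : a ≤ b -> ½ a ≤ ½ b.
Proof. by move=> ab; apply: delta_mono => -[|i] /=. Qed.

Lemma half_le a : ½ a ≤ a.
Proof. by rewrite -[X in _ ≤ X]delta_cst; apply: delta_mono => -[|i] /=. Qed.

Lemma half_add_half a : ½ a ⊕ ½ a = a.
Proof. by rewrite -[RHS]delta_cst delta_rec delta_cst. Qed.

(** Monotonicity reduces this to [1 ⊖ ½ 1 = ½ 1], which is axioms (i) and (iv) at the constant
    sequence 1. It guarantees that a sum of two halves is never truncated. *)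
Lemma half_le_neg_half a b : ½ a ≤ ¬ ½ b.
Proof.
have [dec [_ [_ [shift _]]]] := dDelta A.
have h1 : (1 : A) ⊖ ½ 1 = ½ 1.
  have := dec (fun=> 1); rewrite delta_cst mv_dist_ge; last exact: half_le.
  move=> e; rewrite [LHS]e -[X in ½ X]delta_cst -[RHS]shift.
  by congr ddelta; apply: funext => -[].
apply: (@mv_le_trans _ (½ 1)); first exact: half_mono.
rewrite -h1 mv_subE mv_neg1 mv_add0l -mv_le_neg; exact: half_mono.
Qed.

Lemma sub_half a : a ⊖ ½ a = ½ a.
Proof.
by rewrite -[X in X ⊖ _]half_add_half mv_addK //; exact: half_le_neg_half.
Qed.

(** Halving commutes with [⊖], and [(a ⊕ a) ⊖ a = a] because [a ⊕ a] is not truncated. *)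
Lemma half_double a : a ≤ ¬ a -> ½ (a ⊕ a) = a.
Proof.
move=> aa; have le : ½ a ≤ ½ (a ⊕ a) by apply: half_mono; exact: mv_le_addr.
by rewrite -(mv_subK le) -half_sub mv_addK // half_add_half.
Qed.

Definition dyadic n : A := iter n (@mv_half A) 1.

Lemma dyadicS n : 2 · dyadic n.+1 = dyadic n.
Proof. by rewrite mv_mulS mv_mul1 half_add_half. Qed.

Lemma dyadicD m n : 2 ^ m · dyadic (m + n) = dyadic n.
Proof.
elim: m => [|m IH]; first by rewrite mv_mul1.
by rewrite expnSr mv_mulA addSn dyadicS.
Qed.

Lemma dyadic1 n : 2 ^ n · dyadic n = 1.
Proof. by rewrite -[in dyadic _](addn0 n) dyadicD. Qed.

Lemma neg_half a : ¬ ½ a = ¬ a ⊕ ½ a.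
Proof. by rewrite -[X in ¬ X]sub_half mv_subE mv_negK. Qed.

Lemma neg_dyadic n : ¬ dyadic n = (2 ^ n).-1 · dyadic n.
Proof.
elim: n => [|n IH]; first exact: mv_neg1.
have -> : (2 ^ n.+1).-1 = ((2 ^ n).-1 * 2 + 1)%N.
  by have := expn_gt0 2 n; rewrite expnS; lia.
by rewrite mv_mulDl mv_mulA dyadicS -IH mv_mul1 -neg_half.
Qed.

Lemma neg_mul_dyadic n m : (m <= 2 ^ n)%N ->
  ¬ (m · dyadic n) = (2 ^ n - m) · dyadic n.
Proof.
elim: m => [|m IH] mn; first by rewrite subn0 dyadic1.
have -> : ¬ (m.+1 · dyadic n) = ¬ (m · dyadic n) ⊖ dyadic n.
  by rewrite mv_subE mv_negK mv_mulS mv_addC.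
rewrite IH; last exact: ltnW.
have -> : (2 ^ n - m = (2 ^ n - m.+1).+1)%N by lia.
rewrite mv_mulS mv_addC mv_addK // neg_dyadic.
by apply: mv_mul_le2; lia.
Qed.

(* If [a] is infinitesimal then so is [b = δ(a, 2a, 4a, ...)], and the axioms
   give [b = ½a ⊕ b]; cancelling [b] yields [½a = 0]. *)
Lemma archimedean a : (forall n, a ≤ dyadic n) -> a = 0.
Proof.
move=> a_small; pose x i := 2 ^ i · a; pose b := ddelta x.
(* The bound 1/2 keeps later sums below truncation: it permits both [half_double] on each [x i] and
   the final cancellation of [b]. *)
have x_small i : x i ≤ ½ 1.
  apply: (mv_le_trans (mv_mul_le (2 ^ i) (a_small (i + 1)%N))).
  by rewrite dyadicD.
have hb : ½ (ddelta (fun i => x i.+1)) = b.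
  rewrite delta_half; congr ddelta; apply: funext => i.
  rewrite /x expnS mv_mulA mv_mulS mv_mul1 half_double //.
  apply: (mv_le_trans (x_small i)); apply: (mv_le_trans (half_le_neg_half _ 1)).
  by rewrite -mv_le_neg; exact: x_small.
have e : b = ½ a ⊕ b by rewrite {1}/b delta_rec hb /x mv_mul1.
have b_small : b ≤ ½ 1 by rewrite -[X in _ ≤ X]delta_cst; apply: delta_mono.
have : ½ a = 0.
  rewrite -(@mv_addK _ (½ a) b); first by rewrite -e mv_subxx.
  apply: (mv_le_trans (half_le_neg_half _ 1)); by rewrite -mv_le_neg; exact: b_small.
by move=> e0; rewrite -(half_add_half a) e0 mv_add0.
Qed.

End DeltaAlgebra.

Lemma eq_dyadic_close (c u v : R) : (forall n, `|u - v| <= c / 2 ^+ n) -> u = v.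
Proof.
move=> uv; apply/eqP; rewrite -subr_eq0 -normr_le0 leNgt; apply/negP => d_gt0.
have c_ge0 : 0 <= c by have := uv 0%N; rewrite expr0 divr1; apply: le_trans.
have := archi_boundP (divr_ge0 c_ge0 (ltW d_gt0)); set N := Num.bound _ => cN.
have := uv N; rewrite ler_pdivlMr ?exprn_gt0 // => le.
have : N%:R < 2 ^+ N :> R by rewrite -natrX ltr_nat ltn_expl.
rewrite ltr_pdivrMr // in cN; rewrite -(ltr_pM2r d_gt0) => lt.
by have := lt_trans cN lt; rewrite mulrC ltNge le.
Qed.

(** * Prime ideals and homomorphisms into [0,1] *)

Section PrimeIdeal.
Local Open Scope mv_scope.
Context {A : deltaAlg}.
Implicit Types (a b c x y : A) (P : set A).

(* The empty set is not excluded, so that Zorn's lemma applies to chains that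
   may be empty. *)
Definition mv_ideal P :=
  (forall a b, a ≤ b -> P b -> P a) /\ (forall a b, P a -> P b -> P (a ⊕ b)).

Definition mv_prime P :=
  [/\ mv_ideal P, P 0, ~ P 1 & forall a b, P (a ⊖ b) \/ P (b ⊖ a)].

Lemma mv_ideal_mul P a n : mv_ideal P -> P 0 -> P a -> P (n · a).
Proof. by move=> [_ Padd] P0 Pa; elim: n => // n IH; apply: Padd. Qed.

(** An ideal [P] maximal among those omitting [b] is prime. If both differences of [x] and [y] were
    outside [P], then [b] would be bounded by an element of [P] plus a multiple of either one. These
    multiples are disjoint, which puts [b] itself below an element of [P]. *)
Lemma prime_avoiding b : b <> 0 -> exists2 P, mv_prime P & ~ P b.
Proof.
move=> b0; pose Q P := mv_ideal P /\ ~ P b.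
have [|P [[[Pdown Padd] Pb] Pmax]] := @Zorn_bigcup A Q.
  move=> F FQ Ftot; split; last by move=> [X /FQ[_ Xb] /Xb].
  split=> [c d cd [X FX Xd]|c d [X FX Xc] [Y FY Yd]].
    by exists X => //; have [[Xdown _] _] := FQ _ FX; apply: Xdown Xd.
  have [XY|YX] := Ftot _ _ FX FY.
    by exists Y => //; have [[_ Yadd] _] := FQ _ FY; apply: Yadd => //; apply: XY.
  by exists X => //; have [[_ Xadd] _] := FQ _ FX; apply: Xadd => //; apply: YX.
(* A maximal [P] without 0 would be empty, hence properly contained in the ideal [[set 0]]. *)
have P0 : P 0.
  apply: contrapT => P0; apply: (Pmax [set 0]).
    split; first by move=> a Pa; exfalso; apply: P0; apply: Pdown Pa.
    by move=> /(_ _ erefl).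
  split; last by move=> /b0.
  split=> [c d + /= d0|c d /= -> ->]; last by rewrite mv_add0.
  by rewrite d0 => /mv_lex0.
have ext u : ~ P u -> exists p n, P p /\ b ≤ p ⊕ n · u.
  move=> Pu; apply: contrapT => nb.
  (* The competitor is the ideal generated by [P] and [u]. *)
  apply: (Pmax [set w | exists p n, P p /\ w ≤ p ⊕ n · u]).
    split; first by move=> a Pa; exists a, 0%N; rewrite mv_add0.
    move=> /(_ u) H; apply/Pu/H; exists 0, 1%N; split=> //.
    by rewrite mv_mul1; exact: mv_le_addl.
  split=> //; split=> [c d cd [p [n [Pp dp]]]|].
    by exists p, n; split=> //; apply: mv_le_trans dp.
  move=> c d [p [n [Pp cp]]] [q [m [Pq dq]]]; exists (p ⊕ q), (n + m)%N.
  split; first exact: Padd.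
  rewrite mv_mulDl mv_addA (mv_addAC p) -mv_addA.
  exact: mv_le_add.
exists P => //; split=> //; first by move=> P1; apply: Pb; apply: Pdown P1.
move=> x y; apply: contrapT => /not_orP[/ext[p [n [Pp bp]]] /ext[q [m [Pq bq]]]].
apply/Pb/(Pdown _ (p ⊕ q)); last exact: Padd.
rewrite -mv_sub_eq0.
apply: (@mv_disjoint_mul A n m _ _ (@mv_sub_disjoint A x y)); rewrite mv_le_subl.
  by apply: (mv_le_trans bp); apply: mv_le_add => //; exact: mv_le_addr.
by apply: (mv_le_trans bq); apply: mv_le_add => //; exact: mv_le_addl.
Qed.

(** * Dyadic approximation modulo a prime ideal *)

Section Quotient.
Context {P : set A} (primeP : mv_prime P).

Lemma prime_down a b : a ≤ b -> P b -> P a.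
Proof. by have [[h _] _ _ _] := primeP; apply: h. Qed.

Lemma prime_total a b : P (a ⊖ b) \/ P (b ⊖ a).
Proof. by have [_ _ _ h] := primeP; apply: h. Qed.

Lemma prime_le a b : a ≤ b -> P (a ⊖ b).
Proof. by move/mv_sub_eq0 => ->; have [] := primeP. Qed.

Lemma prime_trans b a c : P (a ⊖ b) -> P (b ⊖ c) -> P (a ⊖ c).
Proof.
have [[_ Padd] _ _ _] := primeP => ab bc; apply: prime_down (Padd _ _ ab bc).
rewrite mv_le_subl (mv_addC (a ⊖ b)) mv_addA.
apply: (@mv_le_trans _ (b ⊕ (a ⊖ b))); first by rewrite -mv_le_subl.
by apply: mv_le_add => //; rewrite -mv_le_subl.
Qed.

Lemma prime_add a b c d : P (a ⊖ b) -> P (c ⊖ d) -> P (a ⊕ c ⊖ (b ⊕ d)).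
Proof.
have [[_ Padd] _ _ _] := primeP => ab cd; apply: prime_down (Padd _ _ ab cd).
rewrite mv_le_subl mv_addA (mv_addAC b) -mv_addA.
by apply: mv_le_add; rewrite -mv_le_subl.
Qed.

Lemma prime_neg a b : P (a ⊖ b) -> P (¬ b ⊖ ¬ a).
Proof. by rewrite !mv_subE mv_negK mv_addC. Qed.

Lemma prime_dyadicF n : ~ P (dyadic n).
Proof.
have [idealP P0 P1 _] := primeP => Pd; apply: P1; rewrite -(dyadic1 n).
exact: mv_ideal_mul.
Qed.

(** If [k < m], the difference is at least [dyadic n], which would then belong to [P]; but [2 ^ n]
    copies of [dyadic n] add up to 1. *)
Lemma prime_mul_dyadic n m k : (m <= 2 ^ n)%N -> (k <= 2 ^ n)%N ->
  P (m · dyadic n ⊖ k · dyadic n) -> (m <= k)%N.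
Proof.
move=> mn kn Pmk; rewrite leqNgt; apply/negP => km; apply: (@prime_dyadicF n).
apply: prime_down Pmk; rewrite -{1}(subnK (ltnW km)) mv_mulDl mv_addK.
  by rewrite -{1}(mv_mul1 (dyadic n)); apply: mv_mul_le2; lia.
by rewrite neg_mul_dyadic //; apply: mv_mul_le2; lia.
Qed.

Lemma prime_mul_dyadic2 n l m k : (m <= 2 ^ n)%N -> (k <= 2 ^ l)%N ->
  P (m · dyadic n ⊖ k · dyadic l) -> m%:R / 2 ^+ n <= k%:R / 2 ^+ l :> R.
Proof.
move=> mn kl; rewrite -[dyadic n](dyadicD l) -[dyadic l](dyadicD n).
rewrite (addnC l) -!mv_mulA => /prime_mul_dyadic H.
have : (m * 2 ^ l <= k * 2 ^ n)%N.
  by apply: H; rewrite expnD; [rewrite leq_mul | rewrite mulnC leq_mul].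
rewrite ler_pdivrMr ?exprn_gt0 // mulrAC ler_pdivlMr ?exprn_gt0 //.
by rewrite -!natrX -!natrM ler_nat.
Qed.

Lemma mul_dyadic_min n m : m · dyadic n = minn m (2 ^ n) · dyadic n :> A.
Proof.
have [//|nm] := leqP m (2 ^ n); rewrite dyadic1.
by apply: mv_le_anti => //; rewrite -(dyadic1 n); apply: mv_mul_le2; lia.
Qed.

(* The quotient by [P] is a chain in which every element is squeezed between
   consecutive multiples of [1/2^n], and [prime_val] is the resulting Dedekind
   cut. *)
Definition prime_val x : R := sup [set r | exists m n,
  [/\ (m <= 2 ^ n)%N, P (m · dyadic n ⊖ x) & r = m%:R / 2 ^+ n]].

Lemma prime_val_le n m x : P (x ⊖ m · dyadic n) ->
  (prime_val x <= Num.min 1 (m%:R / 2 ^+ n))%R.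
Proof.
rewrite mul_dyadic_min; set k := minn _ _ => xk.
have kn : (k <= 2 ^ n)%N by rewrite geq_minr.
have kE : (k%:R / 2 ^+ n <= Num.min 1 (m%:R / 2 ^+ n) :> R)%R.
  rewrite le_min ler_pdivrMr ?exprn_gt0 // mul1r -natrX ler_nat kn /=.
  by apply: ler_wpM2r; rewrite ?invr_ge0 ?exprn_ge0 // ler_nat geq_minl.
apply: le_trans kE; apply: ge_sup.
  exists 0%R, 0%N, 0%N; split=> //; last by rewrite mul0r.
  exact: prime_le.
move=> _ [j [l [jl Pj ->]]]; apply: prime_mul_dyadic2 => //.
exact: prime_trans Pj xk.
Qed.

Lemma prime_val_ge n m x : P (m · dyadic n ⊖ x) ->
  (Num.min 1 (m%:R / 2 ^+ n) <= prime_val x)%R.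
Proof.
rewrite mul_dyadic_min; set k := minn _ _ => kx.
have kn : (k <= 2 ^ n)%N by rewrite geq_minr.
have kE : (Num.min 1 (m%:R / 2 ^+ n) = k%:R / 2 ^+ n :> R)%R.
  rewrite /k; have [mn|nm] := leqP m (2 ^ n).
    by rewrite min_r // ler_pdivrMr ?exprn_gt0 // mul1r -natrX ler_nat.
  rewrite natrX divff ?expf_neq0 ?pnatr_eq0 // min_l //.
  by rewrite ler_pdivlMr ?exprn_gt0 // mul1r -natrX ler_nat ltnW.
rewrite kE; apply: ub_le_sup; last by exists k, n.
exists 1%R => _ [j [l [jl _ ->]]].
by rewrite ler_pdivrMr ?exprn_gt0 // mul1r -natrX ler_nat.
Qed.

(** Climb the multiples of [dyadic n], comparing each with [x] by totality, until one passes [x]. If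
    even the last, which equals 1, stays below [x] modulo [P], the top interval serves. *)
Lemma prime_bracket n x : exists m,
  [/\ (m < 2 ^ n)%N, P (m · dyadic n ⊖ x) & P (x ⊖ m.+1 · dyadic n)].
Proof.
have : P ((2 ^ n) · dyadic n ⊖ x) \/ exists m,
    [/\ (m < 2 ^ n)%N, P (m · dyadic n ⊖ x) & P (x ⊖ m.+1 · dyadic n)].
  have : (2 ^ n <= 2 ^ n)%N by [].
  elim: {1 3}(2 ^ n)%N => [_|k IH kn]; first by left; exact: prime_le.
  have [Pk|] := IH (ltnW kn); last by right.
  have [Pk1|Pk1] := prime_total (k.+1 · dyadic n) x; first by left.
  by right; exists k.
move=> [Px|//]; exists (2 ^ n).-1; have n0 : (0 < 2 ^ n)%N by rewrite expn_gt0.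
rewrite prednK //; split=> //; last by rewrite dyadic1; exact: prime_le.
by apply: prime_down Px; apply: mv_le_sub => //; apply: mv_mul_le2; lia.
Qed.

(** Brackets of width 1/2^n for the arguments yield brackets for the result, because the operations
    respect the order modulo [P]. Both sides of each law thus agree up to a fixed multiple of 1/2^n,
    for every [n]. *)
Lemma prime_val_hom : mvhom01 (@dadd A) (@dneg A) (dzero A) prime_val.
Proof.
have P0 a : P (0 ⊖ a) by exact: prime_le.
have bracket n x : exists m, [/\ (m < 2 ^ n)%N, P (m · dyadic n ⊖ x),
    P (x ⊖ m.+1 · dyadic n) &
    (m%:R / 2 ^+ n <= prime_val x <= m%:R / 2 ^+ n + 1 / 2 ^+ n)%R].
  have [m [mn Pm Pm1]] := prime_bracket n x; exists m; split=> //.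
  have := prime_val_ge Pm; have := prime_val_le Pm1.
  rewrite -[m.+1]addn1 natrD mulrDl le_min => /andP[_ ->]; rewrite andbT.
  rewrite min_r // ler_pdivrMr ?exprn_gt0 // mul1r -natrX ler_nat; exact: ltnW.
split; last split; last split.
- move=> a; apply/andP; split.
    by have := @prime_val_ge 0 0 a (P0 _); rewrite mul0r min_r.
  have := @prime_val_le 0 1 a (prime_le _); rewrite divr1 minxx; apply.
  by rewrite mv_mul1.
- move=> x y; apply: (@eq_dyadic_close 2) => n.
  have [m [mn mx xm hx]] := bracket n x.
  have [k [kn ky yk hy]] := bracket n y.
  have := @prime_val_ge n (m + k) (x ⊕ y).
  have := @prime_val_le n (m.+1 + k.+1) (x ⊕ y).
  rewrite !mv_mulDl => /(_ (prime_add xm yk)) + /(_ (prime_add mx ky)).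
  rewrite -[m.+1]addn1 -[k.+1]addn1 !natrD !mulrDl /unit_add.
  have e0 : (0 < 1 / 2 ^+ n :> R)%R by rewrite divr_gt0 ?exprn_gt0.
  move: e0 hx hy; set X := (m%:R / _)%R; set Y := (k%:R / _)%R.
  set E := (1 / _)%R; set H := prime_val (_ ⊕ _).
  move: X Y E H (prime_val x) (prime_val y) => X Y E H hx hy.
  rewrite ler_norml !minEle; do !case: ifPn; lra.
- move=> x; apply: (@eq_dyadic_close 1%R) => n.
  have [m [mn mx xm hx]] := bracket n x.
  have := @prime_val_ge n (2 ^ n - m.+1) (¬ x).
  have := @prime_val_le n (2 ^ n - m) (¬ x).
  rewrite -!neg_mul_dyadic ?(ltnW mn) //.
  move=> /(_ (prime_neg mx)) + /(_ (prime_neg xm)).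
  rewrite !natrB ?(ltnW mn) // !mulrBl natrX divff ?expf_neq0 ?pnatr_eq0 //.
  rewrite -[m.+1]addn1 natrD mulrDl.
  have e0 : (0 < 1 / 2 ^+ n :> R)%R by rewrite divr_gt0 ?exprn_gt0.
  have m0 : (0 <= m%:R / 2 ^+ n :> R)%R by rewrite divr_ge0 // exprn_ge0.
  move: e0 m0 hx; rewrite /unit_neg; set X := (m%:R / _)%R; set E := (1 / _)%R.
  move: X E (prime_val (¬ x)) (prime_val x) => X E H hx.
  rewrite ler_norml !minEle; do !case: ifPn; lra.
- apply/le_anti/andP; split.
    by have := @prime_val_le 0 0 0 (P0 _); rewrite mul0r min_r.
  by have := @prime_val_ge 0 0 0 (P0 _); rewrite mul0r min_r.
Qed.

End Quotient.

(** A nonzero distance [c] would be at least some [dyadic n] modulo a suitable prime, so [prime_val]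
    would be positive at [c]; yet its value there is computed from the equal values at [a] and [b],
    and is 0. *)
Lemma mv_hom_separates a b :
  (forall h : A -> R, mvhom01 (@dadd A) (@dneg A) (dzero A) h -> h a = h b) -> a = b.
Proof.
move=> hab; apply: mv_dist_eq0; set c := d_dist _ _ _ _.
apply: contrapT => c0.
have [n cn] : exists n, ~ (c ≤ dyadic n).
  by apply: contrapT => /forallNP H; apply/c0/archimedean => n; apply: contrapT => /H.
have [P primeP Pc] := @prime_avoiding (c ⊖ dyadic n) (fun e => cn ((mv_sub_eq0 _ _).1 e)).
have [//|Pnc] := prime_total primeP c (dyadic n).
have hom := prime_val_hom primeP; pose h := @prime_val P.
have hc : (0 < h c)%R.
  have Pn : P (1 · dyadic n ⊖ c) by rewrite mv_mul1.
  apply: (lt_le_trans _ (prime_val_ge Pn)).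
  by rewrite lt_min ltr01 divr_gt0 ?exprn_gt0.
have [h01 [hD [hN _]]] : mvhom01 (@dadd A) (@dneg A) (dzero A) h := hom.
move: hc; rewrite /c /d_dist /d_ominus /d_odot !(hD, hN) (hab h hom).
rewrite /unit_add /unit_neg; have := h01 b; move: (h b) => hb.
by rewrite !minEle; do !case: ifPn; lra.
Qed.

End PrimeIdeal.

(** * Dyadic series of reals *)

Section DyadicSeries.
Import numFieldNormedType.Exports.

Lemma limn_dyadic_close (K : realType) (u : nat -> K) (l c : K) :
  (forall n, `|l - u n| <= c / 2 ^+ n) -> limn u = l.
Proof.
move=> H; apply/cvg_lim; first exact: Rhausdorff.
have cv : geometric c (2^-1 : K) @ \oo --> (0 : K).
  by apply: cvg_geometric; rewrite ger0_norm ?invr_ge0 // invf_lt1 // ltr1n.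
move/cvgrPdist_le : cv => cv.
apply/cvgrPdist_le => e /cv; apply: filterS => n.
rewrite sub0r normrN /= exprVn; apply: le_trans.
exact: le_trans (H n) (ler_norm _).
Qed.

Lemma limn_dyadic_sum_bounds (K : realType) (x : nat -> K) :
  (forall i, 0 <= x i <= 1) ->
  let S n := \sum_(0 <= i < n) (x i / 2 ^+ i.+1) in
  forall n, S n <= limn S <= S n + 1 / 2 ^+ n.
Proof.
move=> x01 S.
(* Equivalently, [S n + 1 / 2 ^ n] is nonincreasing; keeping the subtracted term is what lets the
   induction close. *)
have S_le n m : S (n + m)%N <= S n + 1 / 2 ^+ n - 1 / 2 ^+ (n + m).
  elim: m => [|m IH]; first by rewrite addn0 addrK.
  rewrite addnS {1}/S big_nat_recr //= -/(S (n + m)%N).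
  set N := (n + m)%N in IH *.
  have eN : 1 / 2 ^+ N = 1 / 2 ^+ N.+1 + 1 / 2 ^+ N.+1 :> K.
    by rewrite exprS; field; rewrite expf_neq0 ?pnatr_eq0.
  have : x N / 2 ^+ N.+1 <= 1 / 2 ^+ N.+1.
    by apply: ler_wpM2r; [rewrite invr_ge0 exprn_ge0|case/andP: (x01 N)].
  lra.
have ndS : nondecreasing_seq S.
  apply/nondecreasing_seqP => n; rewrite {2}/S big_nat_recr //= lerDl.
  by apply: divr_ge0; [case/andP: (x01 n)|rewrite exprn_ge0].
have e_ge0 n : 0 <= 1 / 2 ^+ n :> K by rewrite divr_ge0 ?exprn_ge0.
have cvS : cvgn S.
  apply: nondecreasing_is_cvgn => //; exists 1 => _ [n _ <-].
  have := S_le 0%N n; have := e_ge0 n; rewrite /S add0n big_nil expr0 divr1; lra.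
move=> n; apply/andP; split; first exact: nondecreasing_cvgn_le.
apply: limr_le => //; near=> m.
have nm : (n <= m)%N by near: m; exists n.
have := S_le n (m - n)%N; rewrite subnKC //; have := e_ge0 m; lra.
Unshelve. all: by end_near.
Qed.

End DyadicSeries.

Definition dyadic_sum (x : nat -> R) n : R := \sum_(0 <= i < n) (x i / 2 ^+ i.+1).

Lemma dyadic_sumS x n :
  dyadic_sum x n.+1 = x 0%N / 2 + dyadic_sum (fun i => x i.+1) n / 2.
Proof.
rewrite /dyadic_sum big_nat_recl // expr1; congr (_ + _).
by rewrite mulr_suml; apply: eq_bigr => i _; rewrite (exprS _ i.+1) invfM mulrCA mulrC.
Qed.

Lemma unit_deltaP x l c :
  (forall n, `|l - dyadic_sum x n| <= c / 2 ^+ n) -> unit_delta x = l.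
Proof. exact: (@limn_dyadic_close R). Qed.

Lemma unit_delta_approx x n : (forall i, 0 <= x i <= 1) ->
  dyadic_sum x n <= unit_delta x <= dyadic_sum x n + 1 / 2 ^+ n.
Proof. by move=> x01; exact: (@limn_dyadic_sum_bounds R x x01 n). Qed.

Lemma unit_delta_bounds x : (forall i, 0 <= x i <= 1) -> 0 <= unit_delta x <= 1.
Proof.
move=> x01; have := unit_delta_approx 0 x01.
by rewrite /dyadic_sum big_nil expr0 divr1 add0r.
Qed.

(** The recursion has only one bounded solution: unrolling it [n] times leaves an error of at most
    1/2^n. *)
Lemma unit_delta_coind (T : Type) (D : (nat -> T) -> R) (h : T -> R) :
  (forall x, 0 <= D x <= 1) ->
  (forall x, D x = h (x 0%N) / 2 + D (fun i => x i.+1) / 2) ->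
  forall x, D x = unit_delta (fun i => h (x i)).
Proof.
move=> D01 Drec x; apply/esym/(@unit_deltaP _ _ 1) => n.
elim: n x => [|n IH] x.
  by rewrite /dyadic_sum big_nil subr0 expr0 divr1; have /andP[? ?] := D01 x;
     rewrite ger0_norm.
rewrite Drec dyadic_sumS opprD addrACA subrr add0r -mulrBl normrM.
rewrite [X in _ * X]ger0_norm ?invr_ge0 // exprS invfM mulrA (mulrAC 1).
by apply: ler_wpM2r; rewrite ?invr_ge0.
Qed.

Lemma unit_delta_rec x : (forall i, 0 <= x i <= 1) ->
  unit_delta x = x 0%N / 2 + unit_delta (fun i => x i.+1) / 2.
Proof.
move=> x01; have y01 i : 0 <= x i.+1 <= 1 by exact: x01.
apply: (@unit_deltaP _ _ 1) => -[|n].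
  rewrite /dyadic_sum big_nil subr0 expr0 divr1.
  have := unit_delta_bounds y01; have := x01 0%N => *.
  by rewrite ger0_norm; lra.
have := unit_delta_approx n y01.
rewrite dyadic_sumS opprD addrACA subrr add0r -mulrBl exprS invfM mulrA (mulrAC 1).
by move=> *; rewrite ler_norml; lra.
Qed.

Lemma unit_delta_cst a : 0 <= a <= 1 -> unit_delta (fun=> a) = a.
Proof. by move=> a01; have := @unit_delta_rec (fun=> a) (fun=> a01); lra. Qed.

Lemma unit_delta_half x : (forall i, 0 <= x i <= 1) ->
  unit_delta x / 2 = unit_delta (fun i => x i / 2).
Proof.
move=> x01; apply/esym/(@unit_deltaP _ _ 1) => n.
have -> : dyadic_sum (fun i => x i / 2) n = dyadic_sum x n / 2.
  by rewrite /dyadic_sum mulr_suml; apply: eq_bigr => i _; rewrite mulrAC.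
by have := unit_delta_approx n x01 => *; rewrite ler_norml; lra.
Qed.

Lemma unit_delta_mono x y : (forall i, 0 <= x i <= 1) -> (forall i, 0 <= y i <= 1) ->
  (forall i, x i <= y i) -> unit_delta x <= unit_delta y.
Proof.
move=> x01 y01 xy.
(* The inequality is recast as an equation so that [eq_dyadic_close] applies. *)
have mE : Num.max (unit_delta x) (unit_delta y) = unit_delta y.
  apply: (@eq_dyadic_close 1) => n.
  have := unit_delta_approx n x01; have := unit_delta_approx n y01.
  have : dyadic_sum x n <= dyadic_sum y n.
    by apply: ler_sum => i _; apply: ler_wpM2r => //; rewrite invr_ge0 exprn_ge0.
  move=> *; rewrite ler_norml maxEle; case: ifPn; lra.
by rewrite -mE le_max lexx.
Qed.

Lemma unit_delta_head a : 0 <= a <= 1 ->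
  unit_delta (fun i => if i is 0 then a else 0) = a / 2.
Proof.
move=> a01; rewrite unit_delta_rec; last by case=> [|_]; rewrite ?lexx ?ler01.
by rewrite /= unit_delta_cst ?lexx ?ler01 // mul0r addr0.
Qed.

(** * The standard δ-algebra *)

Definition unit_car := {x : R | 0 <= x <= 1}.

Section UnitAlgebra.
Implicit Types a b : unit_car.

Lemma unit_inj a b : sval a = sval b -> a = b.
Proof. exact: val_inj. Qed.
Lemma unit_add_bounds a b : 0 <= unit_add (sval a) (sval b) <= 1.
Proof. by case: a b => [x ?] [y ?] /=; rewrite /unit_add minEle; case: ifPn; lra. Qed.
Lemma unit_neg_bounds a : 0 <= unit_neg (sval a) <= 1.
Proof. by case: a => [x ?] /=; rewrite /unit_neg; lra. Qed.
Lemma unit_zero_bounds : 0 <= (0 : R) <= 1.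
Proof. by rewrite lexx ler01. Qed.
Lemma unit_dlt_bounds (u : nat -> unit_car) : 0 <= unit_delta (fun i => sval (u i)) <= 1.
Proof. by apply: unit_delta_bounds => i; case: (u i). Qed.

Definition uadd a b : unit_car := exist (fun x : R => 0 <= x <= 1) _ (unit_add_bounds a b).
Definition uneg a : unit_car := exist (fun x : R => 0 <= x <= 1) _ (unit_neg_bounds a).
Definition uzero : unit_car := exist (fun x : R => 0 <= x <= 1) _ unit_zero_bounds.
Definition udelta u : unit_car := exist (fun x : R => 0 <= x <= 1) _ (unit_dlt_bounds u).

Lemma unit_is_MV : is_MV uadd uneg uzero.
Proof.
repeat split; move=> *; apply: unit_inj => /=;
  repeat match goal with a : unit_car |- _ => case: a => a ? /= end;
  rewrite /unit_add /unit_neg ?minEle; do ?case: ifPn; lra.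
Qed.

Lemma sval_uhalf a : sval (d_half uzero udelta a) = sval a / 2.
Proof.
rewrite /d_half /= -unit_delta_head; last by case: a.
by congr unit_delta; apply: funext => -[].
Qed.

Lemma unit_is_delta : is_delta_axioms uadd uneg uzero udelta.
Proof.
have u01 (u : nat -> unit_car) i : 0 <= sval (u i) <= 1 by case: (u i).
split; last split; last split; last split; last split.
- move=> u; apply: unit_inj => /=.
  have -> : unit_delta (fun i => sval match i with 0 => u 0%N | _.+1 => uzero end)
      = sval (u 0%N) / 2 by rewrite -sval_uhalf.
  rewrite unit_delta_rec // [RHS]unit_delta_rec; last first.
    by case=> [|i]; [exact: unit_zero_bounds|exact: u01].
  rewrite /= mul0r add0r; have := u01 u 0%N.
  have := unit_delta_bounds (u01 (fun i => u i.+1)).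
  rewrite /unit_add /unit_neg !minEle => *; do !case: ifPn; lra.
- move=> u; apply: unit_inj; rewrite sval_uhalf [LHS]unit_delta_half //.
  by congr unit_delta; apply: funext => i; exact/esym/sval_uhalf.
- by move=> a; apply: unit_inj; rewrite /= unit_delta_cst //; case: a.
- move=> u; apply: unit_inj; rewrite sval_uhalf /= unit_delta_rec; last first.
    by case=> [|i]; [exact: unit_zero_bounds|exact: u01].
  by rewrite /= mul0r add0r.
- move=> u v; apply: unit_inj => /=.
  have : unit_delta (fun i => sval (u i)) <=
         unit_delta (fun i => unit_add (sval (u i)) (sval (v i))).
    apply: unit_delta_mono => // i; first exact: unit_add_bounds.
    have := u01 u i; have := u01 v i; rewrite /unit_add minEle; case: ifPn; lra.
  have := unit_delta_bounds (u01 u).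
  have := unit_delta_bounds (u01 (fun i => uadd (u i) (v i))).
  rewrite /= /unit_add /unit_neg !minEle => *; do !case: ifPn; lra.
- move=> a b; apply: unit_inj; rewrite sval_uhalf /= -!/(d_half _ _ _).
  have := @sval_uhalf a; have := @sval_uhalf b => /= -> ->.
  case: a b => [x ?] [y ?] /=.
  rewrite /unit_add /unit_neg !minEle => *; do !case: ifPn; lra.
Qed.

Definition unitAlg : deltaAlg := DeltaAlg unit_is_MV unit_is_delta.

End UnitAlgebra.

(** The δ-laws are assumed only after applying [h], so that the lemma covers both δ-algebras and
    terms, where the laws hold only modulo [Feq]. They force [h (half u) = h u / 2], and
    [unit_delta_coind] concludes. *)
Lemma mvhom_delta (T : Type) (add : T -> T -> T) (neg : T -> T) (zero : T)
    (delta : (nat -> T) -> T) (h : T -> R) (half := d_half zero delta) :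
  mvhom01 add neg zero h ->
  (forall x, h (add (half x) (half x)) = h x) ->
  (forall x y, h (d_odot add neg (half x) (half y)) = h zero) ->
  (forall x, h (delta x) = h (add (half (x 0%N)) (half (delta (fun i => x i.+1))))) ->
  forall x, h (delta x) = unit_delta (fun i => h (x i)).
Proof.
move=> [h01 [hD [hN h0]]] hdouble hodot hrec.
have half_le u v : h (half u) + h (half v) <= 1.
  have := hodot u v; rewrite /d_odot !(hD, hN) h0 /unit_add /unit_neg.
  by rewrite minEle; case: ifPn; lra.
have hE u : h (half u) = h u / 2.
  have := hdouble u; rewrite hD /unit_add min_r //; lra.
apply: unit_delta_coind => // x; rewrite hrec hD /unit_add min_r // !hE //.
Qed.

Lemma mvhom_deltaA (A : deltaAlg) (h : A -> R) :
  mvhom01 (@dadd A) (@dneg A) (dzero A) h ->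
  forall x, h (ddelta x) = unit_delta (fun i => h (x i)).
Proof.
move=> hom; apply: (mvhom_delta hom) => [x|x y|x].
- by congr h; exact: half_add_half.
- congr h; rewrite -[RHS]mv_neg1; congr dneg; exact: half_le_neg_half.
- by congr h; exact: delta_rec.
Qed.

(** * Stone-Weierstrass *)

(** Compactness as an induction principle. If [P K] failed, the sets [S] with [P (K \ S)] would form
    a proper filter; a neighbourhood satisfying [P] of a cluster point contradicts clustering. *)
Lemma compact_local_ind (T : topologicalType) (K : set T) (P : set T -> Prop) :
  compact K -> P set0 -> (forall U V, U `<=` V -> P V -> P U) ->
  (forall U V, P U -> P V -> P (U `|` V)) ->
  (forall x, K x -> exists2 U, nbhs x U & P U) -> P K.
Proof.
move=> Kco P0 Pmono PU Ploc; apply: contrapT => PK.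
pose F : set_system T := [set S | P (K `\` S)].
have FF : ProperFilter F.
  apply: Build_ProperFilter_ex.
    move=> S FS; apply: contrapT => nS; apply: PK; apply: Pmono FS.
    by move=> x Kx; split=> // Sx; apply: nS; exists x.
  split; first by rewrite /F /= setDT.
    by move=> S S' FS FS'; rewrite /F /= setDIr; apply: PU.
  by move=> S S' SS'; apply: Pmono => x [Kx nSx]; split=> // /SS'.
have [|x [Kx cl]] := Kco F FF; first by rewrite /F /= setDv.
have [U Ux PUU] := Ploc x Kx.
have /cl/(_ Ux) [y [ncUy Uy]] : F (~` U).
  by apply: Pmono PUU => y [_ /contrapT].
by [].
Qed.

Section RealTopology.
Import numFieldNormedType.Exports.

Lemma nbhs_norm_lt (F : realType) (x eps : F) : 0 < eps ->
  nbhs x [set y | `|x - y| < eps].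
Proof. by move=> e0; exact: (@nbhsx_ballx F F^o x eps e0). Qed.

Lemma within_continuous_double_sub (F : realType) (T : topologicalType) (K : set T)
    (f g : T -> F) :
  {within K, continuous f} -> {within K, continuous g} ->
  {within K, continuous (fun x => 2 * f x - g x)}.
Proof.
by move=> cf cg x; apply: cvgB; [apply: cvgMr; exact: cf|exact: cg].
Qed.

End RealTopology.

Lemma unit_cube_compact (Z : Type) : compact (unit_cube Z).
Proof.
have := @tychonoff {classic Z} (fun=> R) (fun=> [set` `[0, 1]])
  (fun=> @segment_compact R 0 1).
by rewrite (_ : mkset _ = unit_cube Z).
Qed.

Lemma ptws_eval_continuous (Z : Type) (z : Z) :
  continuous (fun h : {ptws Z -> R} => h z).
Proof. exact: (@proj_continuous {classic Z} (fun=> R) z). Qed.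

Lemma ptws_nbhs_close (Z : Type) (z : Z) (g : {ptws Z -> R}) (eps : R) : 0 < eps ->
  nbhs g [set h : {ptws Z -> R} | `|g z - h z| < eps].
Proof.
move=> e0.
have := @ptws_eval_continuous Z z g [set y | `|g z - y| < eps].
by apply; exact: (@nbhs_norm_lt R).
Qed.

Section Homset.
Context {Z : Type} (add : Z -> Z -> Z) (neg : Z -> Z) (zero : Z) (E : Z -> Z -> Prop).

(** With [E] equality on a δ-algebra this is [MaxSet]; with [E] entailment from a theory on terms it
    is the space of [0,1]-valued models of that theory. *)
Definition homset : set {ptws Z -> R} :=
  [set h | mvhom01 add neg zero h /\ forall s t, E s t -> h s = h t].

Lemma homset_closed : closed homset.
Proof.
move=> g clg.
have close a b c (eps : R) : 0 < eps -> exists2 h : Z -> R, homset h &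
    [/\ `|g a - h a| < eps, `|g b - h b| < eps & `|g c - h c| < eps].
  move=> e0; have near z := ptws_nbhs_close z g e0.
  have [h [Hh [[ha hb] hc]]] := clg _ (filterI (filterI (near a) (near b)) (near c)).
  by exists h.
have e_gt0 n : 0 < 1 / 2 ^+ n :> R by rewrite divr_gt0 ?exprn_gt0.
have eqg (u v : R) : (forall n, `|u - v| <= 3 * (1 / 2 ^+ n)) -> u = v.
  by move=> H; apply: (@eq_dyadic_close 3) => n; have := H n; rewrite mulrA mulr1.
split; last first.
  move=> s t st; apply: eqg => n.
  have [h [_ /(_ _ _ st) hst] []] := close s t t _ (e_gt0 n).
  by move: (h s) hst => hs ->; rewrite !ltr_norml ler_norml; lra.
split; last split; last split.
(* Membership in [0,1] is stated as being fixed by truncation, an equation that [eqg] can prove. *)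
- move=> a; suff : g a = Num.max 0 (Num.min 1 (g a)).
    by move=> ->; rewrite le_max lexx /= ge_max ler01 ge_min lexx.
  apply: eqg => n; have [h [[h01 _] _] []] := close a a a _ (e_gt0 n).
  have := h01 a; rewrite !ltr_norml ler_norml minEle maxEle.
  by do !case: ifPn; lra.
- move=> a b; apply: eqg => n.
  have [h [[_ [/(_ a b) hD _]] _] []] := close a b (add a b) _ (e_gt0 n).
  rewrite hD !ltr_norml ler_norml /unit_add !minEle; do !case: ifPn; lra.
- move=> a; apply: eqg => n.
  have [h [[_ [_ [/(_ a) hN _]]] _] []] := close a (neg a) a _ (e_gt0 n).
  by rewrite hN !ltr_norml ler_norml /unit_neg; lra.
- apply: eqg => n.
  have [h [[_ [_ [_ h0]]] _] []] := close zero zero zero _ (e_gt0 n).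
  by rewrite h0 !ltr_norml ler_norml; lra.
Qed.

Lemma homset_compact : compact homset.
Proof.
apply: (subclosed_compact homset_closed (@unit_cube_compact Z)).
by move=> h [[h01 _] _] z; exact: h01.
Qed.

End Homset.

Section StoneWeierstrass.
Context {Z I : Type} (e : I -> Z) (K : set {ptws Z -> R}).
Hypothesis K_compact : compact K.
Hypothesis K_closed : closed K.
Hypothesis K_unit : forall (h : Z -> R) z, K h -> 0 <= h z <= 1.
Hypothesis e_zero : exists i, forall h : Z -> R, K h -> h (e i) = 0.
Hypothesis e_neg : forall i, exists j, forall h : Z -> R, K h ->
  h (e j) = unit_neg (h (e i)).
Hypothesis e_add : forall i j, exists k, forall h : Z -> R, K h ->
  h (e k) = unit_add (h (e i)) (h (e j)).
Hypothesis e_delta : forall u : nat -> I, exists k, forall h : Z -> R, K h ->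
  h (e k) = unit_delta (fun n => h (e (u n))).
Hypothesis e_separates : forall h g : Z -> R, K h -> K g ->
  (forall i, h (e i) = g (e i)) -> h = g.

(** These are the functions given on [K] by members of the family, namely evaluations at coordinates
    [e i]. Below, [e] is the inclusion of terms in xbar, or a δ-homomorphism. *)
Let represented (phi : {ptws Z -> R} -> R) :=
  exists i, forall h : Z -> R, K h -> h (e i) = phi h.

(** [C] is the invariant of the digit expansion: the rescaled residual [p n] stays in it, hence in
    [0,1], so the first [n] digits miss [phi] by at most 1/2^n. *)
Lemma represented_of_step (C : set ({ptws Z -> R} -> R)) :
  (forall phi, C phi -> forall h, K h -> 0 <= phi h <= 1) ->
  (forall phi, C phi -> exists i, C (fun h => 2 * phi h - h (e i))) ->
  C `<=` represented.
Proof.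
move=> C01 Cstep phi Cphi.
have /choice [next nextP] : forall p : {phi | C phi},
    exists i, C (fun h => 2 * sval p h - h (e i)).
  by move=> [psi Cpsi]; exact: Cstep.
pose p0 : {phi | C phi} := exist _ _ Cphi.
pose p n := iter n (fun p => exist C _ (nextP p)) p0.
have [k kP] := e_delta (fun n => next (p n)); exists k => h Kh.
rewrite kP //; apply: (@unit_deltaP _ _ 1) => n.
have -> : phi h = dyadic_sum (fun n => h (e (next (p n)))) n + sval (p n) h / 2 ^+ n.
  elim: n => [|n IH]; first by rewrite /dyadic_sum big_nil expr0 divr1 add0r.
  rewrite IH /dyadic_sum big_nat_recr //= -addrA; congr (_ + _).
  by rewrite exprS invfM mulrBl -mulrA; field; rewrite expf_neq0 ?pnatr_eq0.
rewrite addrAC subrr add0r normrM [X in _ * X]ger0_norm ?invr_ge0 ?exprn_ge0 //.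
apply: ler_wpM2r; first by rewrite invr_ge0 exprn_ge0.
by have /andP[? ?] := C01 _ (svalP (p n)) h Kh; rewrite ger0_norm.
Qed.

Lemma represented_cst (c : R) : 0 <= c <= 1 -> represented (fun=> c).
Proof.
move=> c01; apply: (@represented_of_step [set phi | exists2 c : R, 0 <= c <= 1 &
  forall h, K h -> phi h = c]); last by exists c.
- by move=> phi [d d01 phid] h /phid ->.
move=> phi [d d01 phid]; have [z z0] := e_zero.
(* The digits are those of a binary expansion of the constant. *)
have [d_le|d_gt] := leP d (1 / 2).
  by exists z, (2 * d); [lra|move=> h Kh; rewrite phid // z0 // subr0].
have [o oN] := e_neg z; exists o, (2 * d - 1); first lra.
by move=> h Kh; rewrite phid // oN // z0 // /unit_neg subr0.
Qed.

Lemma e_sub i j : exists k, forall h : Z -> R, K h ->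
  h (e k) = Num.max 0 (h (e i) - h (e j)).
Proof.
have [i' iP] := e_neg i; have [s sP] := e_add i' j; have [k kP] := e_neg s.
exists k => h Kh; rewrite kP // sP // iP //.
have := K_unit (e i) Kh; have := K_unit (e j) Kh.
by rewrite /unit_neg /unit_add minEle maxEle; do !case: ifPn; lra.
Qed.

Lemma e_odot i j : exists k, forall h : Z -> R, K h ->
  h (e k) = Num.max 0 (h (e i) + h (e j) - 1).
Proof.
have [j' jP] := e_neg j; have [k kP] := e_sub i j'; exists k => h Kh.
by rewrite kP // jP // /unit_neg opprB addrA.
Qed.

Lemma e_mul i n : exists k, forall h : Z -> R, K h ->
  h (e k) = Num.min 1 (n%:R * h (e i)).
Proof.
elim: n => [|n [k kP]].
  by have [z zP] := e_zero; exists z => h /zP ->; rewrite mul0r min_r.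
have [s sP] := e_add i k; exists s => h Kh; rewrite sP // kP //.
rewrite -natr1 mulrDl mul1r; have := K_unit (e i) Kh.
by move: (_%:R * _) => x; rewrite /unit_add !minEle; do !case: ifPn; lra.
Qed.

Lemma e_half i j : exists k, forall h : Z -> R, K h ->
  h (e k) = (h (e i) + h (e j)) / 2.
Proof.
have [z zP] := e_zero.
have half l : exists k, forall h : Z -> R, K h -> h (e k) = h (e l) / 2.
  have [k kP] := e_delta (fun n => if n is 0 then l else z); exists k => h Kh.
  rewrite kP // -unit_delta_head; last exact: K_unit.
  by congr unit_delta; apply: funext => -[|n] //; exact: zP.
have [i' iP] := half i; have [j' jP] := half j; have [k kP] := e_add i' j'.
exists k => h Kh; rewrite kP // iP // jP // /unit_add mulrDl min_r //.
by have := K_unit (e i) Kh; have := K_unit (e j) Kh; lra.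
Qed.

(** Choose [i] with [h (e i) < g (e i)] and subtract a constant one third of the way up. The
    truncated difference is 0 near [h] and exceeds [d] near [g], so a multiple [n] with [n d > 1]
    saturates at 1 there. *)
Lemma points_separated (h g : {ptws Z -> R}) : K h -> K g -> h <> g ->
  exists i, (\forall h' \near h, K h' -> h' (e i) = 0) /\
            (\forall g' \near g, K g' -> g' (e i) = 1).
Proof.
move=> Kh Kg hg.
have [i hgi] : exists i, (h (e i) < g (e i)).
  apply: contrapT => /forallNP no; apply: hg.
  apply: e_separates => // i; apply/eqP; rewrite eq_le !leNgt.
  apply/andP; split; apply/negP; last exact: no.
  have [j jP] := e_neg i => gh; apply: (no j).
  by rewrite !jP // /unit_neg; lra.
set a := h (e i) in hgi; set b := g (e i) in hgi.
pose d := (b - a) / 3; have d0 : 0 < d by rewrite /d; lra.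
have [a01 b01] : 0 <= a <= 1 /\ 0 <= b <= 1 by split; exact: K_unit.
have [c cP] := @represented_cst (a + d) ltac:(rewrite /d; lra).
pose n := Num.bound d^-1.
have nd : 1 < n%:R * d.
  by rewrite -ltr_pdivrMr // mul1r; apply: archi_boundP; rewrite invr_ge0 ltW.
have [s sP] := e_sub i c; have [k kP] := e_mul s n; exists k; split.
  have := ptws_nbhs_close (e i) h d0; apply: filterS => h' /= near_h Kh'.
  rewrite kP // sP // cP // max_l ?mulr0 ?min_r //.
  by move: near_h; rewrite -/a ltr_norml; lra.
have := ptws_nbhs_close (e i) g d0; apply: filterS => g' /= near_g Kg'.
rewrite kP // sP // cP // min_l //; apply: (le_trans (ltW nd)).
apply: ler_wpM2l; rewrite // le_max; apply/orP; right.
by move: near_g; rewrite -/b ltr_norml /d; lra.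
Qed.

(** Two nested compactness inductions. Over [K1], truncated sums preserve 0 on [K0] and combine the
    sets where the value is 1; over [K0], [e_odot] preserves 1 near a point and combines the sets
    where the value is 0. *)
Lemma urysohn (K0 K1 : set {ptws Z -> R}) : compact K0 -> compact K1 ->
  K0 `<=` K -> K1 `<=` K -> K0 `&` K1 = set0 ->
  exists i, (forall h : Z -> R, K0 h -> h (e i) = 0) /\
            (forall h : Z -> R, K1 h -> h (e i) = 1).
Proof.
move=> K0co K1co K0K K1K disj.
have [z zP] := e_zero; have [o oP] := e_neg z.
have o1 h : K h -> h (e o) = 1 by move=> Kh; rewrite oP // zP // /unit_neg subr0.
suff : exists i, (forall h : Z -> R, K0 h -> h (e i) = 0) /\
                 (forall h : Z -> R, K h -> K1 h -> h (e i) = 1).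
  by move=> [i [i0 i1]]; exists i; split=> // h K1h; apply: i1 => //; exact: K1K.
apply: (@compact_local_ind _ K1 (fun U => exists i,
    (forall h : Z -> R, K0 h -> h (e i) = 0) /\
    (forall h : Z -> R, K h -> U h -> h (e i) = 1))) => //.
- by exists z; split=> // h /K0K /zP.
- by move=> U V UV [i [i0 i1]]; exists i; split=> // h Kh /UV; exact: i1.
- move=> U V [i [i0 i1]] [j [j0 j1]]; have [k kP] := e_add i j; exists k.
  split=> [h K0h|h Kh UVh].
    by rewrite kP ?i0 ?j0 //; [rewrite /unit_add addr0 min_r|exact: K0K].
  rewrite kP // /unit_add min_l //.
  have := K_unit (e i) Kh; have := K_unit (e j) Kh.
  by case: UVh => [/(i1 _ Kh) ->|/(j1 _ Kh) ->]; lra.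
move=> g K1g; have Kg := K1K _ K1g.
suff [i [i0 i1]] : exists i, (forall h : Z -> R, K h -> K0 h -> h (e i) = 0) /\
    (\forall g' \near g, K g' -> g' (e i) = 1).
  exists [set g' | K g' -> g' (e i) = 1] => //; exists i; split.
    by move=> h K0h; apply: i0 => //; exact: K0K.
  by move=> h Kh /(_ Kh).
apply: (@compact_local_ind _ K0 (fun U => exists i,
    (forall h : Z -> R, K h -> U h -> h (e i) = 0) /\
    (\forall g' \near g, K g' -> g' (e i) = 1))) => //.
- by exists o; split=> //; near=> g'; exact: o1.
- by move=> U V UV [i [i0 i1]]; exists i; split=> // h Kh /UV; exact: i0.
- move=> U V [i [i0 i1]] [j [j0 j1]]; have [k kP] := e_odot i j; exists k.
  split=> [h Kh UVh|].
    rewrite kP // max_l //.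
    have := K_unit (e i) Kh; have := K_unit (e j) Kh.
    by case: UVh => [/(i0 _ Kh) ->|/(j0 _ Kh) ->]; lra.
  near=> g' => Kg'.
  by rewrite kP // (near i1 g' _ Kg') // (near j1 g' _ Kg') // addrK max_r.
move=> h K0h; have Kh := K0K _ K0h.
have hg : h <> g by move=> hg; rewrite -hg in K1g; have : set0 h by rewrite -disj.
have [i [i0 i1]] := points_separated Kh Kg hg.
exists [set h' | K h' -> h' (e i) = 0] => //; exists i.
by split=> // h' Kh' /(_ Kh').
Unshelve. all: by end_near.
Qed.

Lemma within_preimage_compact (phi : {ptws Z -> R} -> R) (D : set R) :
  {within K, continuous phi} -> closed D -> compact (K `&` phi @^-1` D).
Proof.
move=> /continuous_closedP cphi /cphi /closed_subspaceP [V Vcl VK].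
rewrite setIC -VK; apply: (subclosed_compact _ K_compact); last by move=> h [].
exact: closedI.
Qed.

Theorem stone_weierstrass (phi : {ptws Z -> R} -> R) :
  {within K, continuous phi} -> (forall h, K h -> 0 <= phi h <= 1) ->
  exists i, forall h : Z -> R, K h -> h (e i) = phi h.
Proof.
move=> cphi phi01.
pose C : set ({ptws Z -> R} -> R) := fun psi =>
  {within K, continuous psi} /\ forall h, K h -> 0 <= psi h <= 1.
suff sub : C `<=` represented by exact: (sub phi (conj cphi phi01)).
apply: represented_of_step => [psi [] //|].
move=> psi [cpsi psi01].
have level (a b : R) : a < b -> exists i, forall h : Z -> R, K h ->
    (psi h <= a -> h (e i) = 0) /\ (b <= psi h -> h (e i) = 1).
  move=> ab.
  have [|||||i [i0 i1]] := @urysohn (K `&` psi @^-1` [set x | x <= a])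
    (K `&` psi @^-1` [set x | b <= x]).
  - by apply: within_preimage_compact => //; exact: (@closed_le R).
  - by apply: within_preimage_compact => //; exact: (@closed_ge R).
  - by move=> h [].
  - by move=> h [].
  - by rewrite -subset0 => h [[_ /= ha] [_ /= hb]]; lra.
  by exists i => h Kh; split=> ?; [apply: i0|apply: i1].
have [i iP] := level (1 / 4) (1 / 2) ltac:(lra).
have [j jP] := level (1 / 2) (3 / 4) ltac:(lra).
(* The average of the two steps lies between [2 psi - 1] and [2 psi]. *)
have [k kP] := e_half i j; exists k; split.
  apply: (@within_continuous_double_sub R) => //.
  apply: continuous_subspaceT; exact: ptws_eval_continuous.
move=> h Kh; rewrite kP //.
have [i0 i1] := iP h Kh; have [j0 j1] := jP h Kh.
have := K_unit (e i) Kh; have := K_unit (e j) Kh; have := psi01 h Kh.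
have [le14|gt14] := leP (psi h) (1 / 4).
  by rewrite i0 // j0; lra.
have [le12|gt12] := leP (psi h) (1 / 2); first by rewrite j0 //; lra.
have [le34|gt34] := leP (3 / 4) (psi h).
  by rewrite j1 // i1; lra.
by rewrite i1; lra.
Qed.

End StoneWeierstrass.

(** * Beth definability *)

Local Notation eval := Defs.eval.

Lemma eval_rename (A : deltaAlg) (V W : Type) (r : V -> W) (g : W -> A) t :
  eval g (rename r t) = eval (fun v => g (r v)) t.
Proof.
elim: t => [v||s IHs|s IHs u IHu|f IHf] //=; rewrite ?IHs ?IHu //.
by congr ddelta; apply: funext => n; exact: IHf.
Qed.

Lemma eval_half (A : deltaAlg) (W : Type) (g : W -> A) t :
  eval g (d_half tZero (@tDelta W) t) = mv_half (eval g t).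
Proof. by rewrite /= /mv_half; congr ddelta; apply: funext => -[]. Qed.

Lemma MaxF_delta (W : Type) (h : term W -> R) : MaxF h ->
  forall x, h (tDelta x) = unit_delta (fun i => h (x i)).
Proof.
move=> [hF hom]; apply: (mvhom_delta hom) => [x|x y|x]; apply: hF => A g _.
- by rewrite -[RHS]half_add_half -eval_half.
- have e : dadd (dneg (mv_half (eval g x))) (dneg (mv_half (eval g y))) = mv_one A.
    exact: half_le_neg_half.
  by rewrite -[RHS]mv_neg1 -e -!eval_half.
- by rewrite [LHS]delta_rec -(eval_half g (x 0%N)) -(eval_half g (tDelta _)).
Qed.

(** This is the identification of Max F(W) with the cube: preserving δ as well, [h] is determined by
    its values on variables. *)
Lemma MaxF_eval (W : Type) (h : term W -> R) (v : W -> unitAlg) : MaxF h ->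
  (forall w, sval (v w) = h (tVar w)) -> forall t, sval (eval v t) = h t.
Proof.
move=> Mh vE; have [_ [_ [hD [hN h0]]]] := Mh.
elim=> [w||s IHs|s IHs u IHu|f IHf] /=.
- exact: vE.
- by rewrite h0.
- by rewrite hN IHs.
- by rewrite hD IHs IHu.
- by rewrite MaxF_delta //; congr unit_delta; apply: funext => n; exact: IHf.
Qed.

Lemma entails_hom (A : deltaAlg) (W : Type) (S : theory W) (g : W -> A) (h : A -> R) :
  satisfies g S -> mvhom01 (@dadd A) (@dneg A) (dzero A) h ->
  homset (@tAdd W) (@tNeg W) tZero (fun s t => entails S (s, t)) (h \o eval g).
Proof.
move=> gS [h01 [hD [hN h0]]]; split=> [|s t st /=]; last by congr h; exact: st.
by split; [|split; [|split]] => /=.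
Qed.

Lemma homset_MaxF (W : Type) (S : theory W) (h : term W -> R) :
  homset (@tAdd W) (@tNeg W) tZero (fun s t => entails S (s, t)) h -> MaxF h.
Proof. by move=> [hom hS]; split=> // s t st; apply: hS => A g _; exact: st. Qed.

(** Stone-Weierstrass on the space [K] of [0,1]-valued models, with the terms in xbar as family and
    the value of [y] as target. Implicit definability supplies the separation hypothesis. *)
Lemma Beth_definability : Beth_property.
Proof.
move=> X S impl.
pose K := homset (@tAdd (option X)) (@tNeg _) tZero (fun s t => entails S (s, t)).
have hom (h : term (option X) -> R) : K h -> mvhom01 (@tAdd _) (@tNeg _) tZero h.
  by case.
have Kmax (h : term (option X) -> R) : K h -> MaxF h by exact: homset_MaxF.
have [||||||||s sP] := @stone_weierstrass _ (term X) (rename Some) K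
  (@homset_compact _ _ _ _ _) (@homset_closed _ _ _ _ _) _ _ _ _ _ _
  (fun h => h (tVar None)).
- by move=> h z /hom [].
- by exists tZero => h /hom [_ [_ []]].
- by move=> i; exists (tNeg i) => h /hom [_ [_ [hN _]]]; exact: hN.
- by move=> i j; exists (tAdd i j) => h /hom [_ [hD _]]; exact: hD.
- by move=> u; exists (tDelta u) => h /Kmax Mh; exact: MaxF_delta.
- move=> h g Kh Kg hg.
  have [Mh Mg] := (Kmax h Kh, Kmax g Kg).
  pose U (k : term (option X) -> R) (Kk : K k) w : unitAlg :=
    exist (fun x : R => 0 <= x <= 1) (k w) ((hom k Kk).1 w).
  (* Two models that agree on xbar are glued into one assignment, [h] giving the value of [y] and
     [g] that of [z]. *)
  pose v (w : option (option X)) : unitAlg := match w with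
    | None => U h Kh (tVar None)
    | Some None => U g Kg (tVar None)
    | Some (Some x) => U h Kh (tVar (Some x)) end.
  have vh t : sval (eval v (rename (@to_y X) t)) = h t.
    by rewrite eval_rename; apply: MaxF_eval => // -[].
  have vg t : sval (eval v (rename (@to_z X) t)) = g t.
    by rewrite eval_rename; apply: MaxF_eval => // -[x|] //=; exact: (hg (tVar x)).
  have KS k : K k -> forall e, S e -> k e.1 = k e.2.
    by move=> [_ kS] [s t] st; apply: kS => A f; apply.
  have vS : satisfies v (rename_theory (@to_y X) S `|` rename_theory (@to_z X) S).
    move=> _ [[e Se ->]|[e Se ->]] /=; apply: unit_inj.
      by rewrite !vh; exact: KS.
    by rewrite !vg; exact: KS.
  have hgN : h (tVar None) = g (tVar None).
    by have /(congr1 sval) := impl _ v vS.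
  apply: funext => t; rewrite -(@MaxF_eval _ h (fun w => U h Kh (tVar w))) //.
  rewrite -(@MaxF_eval _ g (fun w => U h Kh (tVar w))) // => -[x|] //=.
  exact: (hg (tVar x)).
- apply: continuous_subspaceT; exact: ptws_eval_continuous.
- by move=> h /hom [].
(* Composing a model in [A] with any homomorphism to [0,1] gives a point of [K], so the equation
   [y = s] lifts to [A] by point separation. *)
exists s => A g gS; apply: mv_hom_separates => h hh.
have /= := sP _ (entails_hom gS hh); exact: esym.
Qed.

(** * The map η, epimorphisms and graph theories *)

Lemma MaxSetE (A : deltaAlg) :
  MaxSet A = homset (@dadd A) (@dneg A) (dzero A) eq.
Proof. by apply/seteqP; split=> [h hh|h []] //; split=> // s t ->. Qed.

Lemma MaxSet_compact (A : deltaAlg) : compact (MaxSet A).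
Proof. by rewrite MaxSetE; exact: homset_compact. Qed.

Lemma MaxSet_closed (A : deltaAlg) : closed (MaxSet A).
Proof. by rewrite MaxSetE; exact: homset_closed. Qed.

(** Taking [f] to be the identity gives surjectivity of η; taking it to be an epimorphism gives
    surjectivity of [f]. *)
Lemma stone_weierstrass_Max (A B : deltaAlg) (f : A -> B) : is_delta_hom f ->
  (forall h g : B -> R, MaxSet B h -> MaxSet B g ->
    (forall a, h (f a) = g (f a)) -> h = g) ->
  forall phi : {ptws B -> R} -> R, {within MaxSet B, continuous phi} ->
  (forall h : B -> R, MaxSet B h -> 0 <= phi h <= 1) ->
  exists a : A, forall h : B -> R, MaxSet B h -> h (f a) = phi h.
Proof.
move=> [fdelta [fD [fN f0]]] sep phi cphi phi01.
apply: (@stone_weierstrass _ _ _ _ (@MaxSet_compact B) (@MaxSet_closed B)) => //.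
- by move=> h z [].
- by exists (dzero A) => h [_ [_ [_ h0]]]; rewrite f0.
- by move=> i; exists (dneg i) => h [_ [_ [hN _]]]; rewrite fN.
- by move=> i j; exists (dadd i j) => h [_ [hD _]]; rewrite fD.
- by move=> u; exists (ddelta u) => h hh; rewrite fdelta; exact: mvhom_deltaA.
Qed.

Lemma eta_iso (A : deltaAlg) : eta_is_iso A.
Proof.
split; first by move=> x h hh; exact: mvhom_deltaA.
split; first by move=> a b h [_ [hD _]].
split; first by move=> a h [_ [_ [hN _]]].
split; first by move=> h [_ [_ [_ h0]]].
split; first by move=> a b; exact: mv_hom_separates.
move=> phi; apply: (@stone_weierstrass_Max A A id) => // h g _ _ hg.
exact: funext.
Qed.

Lemma unit_hom (A : deltaAlg) (h : A -> R)
    (hh : mvhom01 (@dadd A) (@dneg A) (dzero A) h) :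
  @is_delta_hom A unitAlg (fun a => exist (fun x : R => 0 <= x <= 1) (h a) (hh.1 a)).
Proof.
have [_ [hD [hN h0]]] := hh.
split; last split; last split.
- by move=> x; apply: unit_inj => /=; exact: mvhom_deltaA.
- by move=> a b; apply: unit_inj; exact: hD.
- by move=> a; apply: unit_inj; exact: hN.
- by apply: unit_inj; exact: h0.
Qed.

(** Evaluation at [b] is continuous on [MaxSet B], hence equals evaluation at some [f a], and point
    separation gives [f a = b]. Separation by the image of [f] is the epimorphism property tested
    against [unitAlg]. *)
Lemma epi_surjective (A B : deltaAlg) (f : A -> B) :
  is_delta_hom f -> is_epi f -> forall b : B, exists a : A, f a = b.
Proof.
move=> homf epif b.
have [|||a aP] := @stone_weierstrass_Max A B f homf _ (fun h => h b).
- move=> h g hh hg hgf; apply: funext => c.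
  have hgU := epif _ _ _ (unit_hom hh) (unit_hom hg).
  apply: (congr1 sval (hgU _ c)) => a.
  by apply: unit_inj; exact: hgf.
- apply: continuous_subspaceT; exact: ptws_eval_continuous.
- by move=> h [].
by exists a; apply: mv_hom_separates => h hh; exact: aP.
Qed.

(** After composing with a homomorphism to [0,1], the [y]-copy and the [z]-copy each give a point of
    V(J), that is, of the graph. The two points share their xbar-coordinates, so their last
    coordinates are the same value of [f]. *)
Lemma Sigma_implicitly_defines (X : Type) (S : set {ptws X -> R})
    (f : {ptws X -> R} -> R) (J : set (term (option X))) :
  zero_set_is J (graph_f S f) -> implicitly_defines (Sigma_of_ideal J).
Proof.
move=> VJ A g gS; apply: mv_hom_separates => h hh /=.
have graph (r : option X -> option (option X)) :
    (forall s, J s -> eval g (rename r s) = dzero A) ->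
    graph_f S f (fun w => h (g (r w))).
  move=> rJ.
  have /homset_MaxF Mh :=
    @entails_hom A _ set0 (fun w => g (r w)) h (fun _ => False_ind _) hh.
  apply: (VJ _ Mh).1 => s Js /=; rewrite -eval_rename rJ //.
  by have [_ [_ [_ h0]]] := hh.
have [|_ [_ ey]] := graph (@to_y X).
  by move=> s Js; apply: (gS (_, tZero)); left; exists (s, tZero) => //; exists s.
have [|_ [_ ez]] := graph (@to_z X).
  by move=> s Js; apply: (gS (_, tZero)); right; exists (s, tZero) => //; exists s.
by rewrite [LHS]ey [RHS]ez.
Qed.

Theorem mainTheorem9 :
  (Beth_property
   <->
   (forall (X : Type) (S : set {ptws X -> R}) (f : {ptws X -> R} -> R),
      (exists2 C : set {ptws X -> R}, closed C & S = C `&` unit_cube X) ->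
      {within S, continuous f} ->
      (forall g, S g -> 0 <= f g <= 1) ->
      forall J : set (term (option X)),
        is_F_ideal J -> zero_set_is J (graph_f S f) ->
        explicitly_defines (Sigma_of_ideal J)))
  /\
  (Beth_property <-> (forall A : deltaAlg, eta_is_iso A))
  /\
  (Beth_property <->
   (forall (A B : deltaAlg) (f : A -> B),
      is_delta_hom f -> is_epi f -> forall b : B, exists a : A, f a = b)).
Proof.
split; last split; split=> _; try exact: Beth_definability.
- move=> X S f _ _ _ J _ VJ; apply: Beth_definability.
  exact: Sigma_implicitly_defines VJ.
- exact: eta_iso.
- exact: epi_surjective.
Qed.
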